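(* Let $\mathcal{H}$ be a real Hilbert space, let $A_1,A_2,A_3$ be bounded linear operators on $\mathcal{H}$, and let $F:\mathcal{H}\to\mathbb{R}^3$ be the quadratic mapping $F(x)=(\langle A_1x,x\rangle,\langle A_2x,x\rangle,\langle A_3x,x\rangle)$. Suppose that there exist $\mu_1,\mu_2,\mu_3\in\mathbb{R}$ such that $\mu_1A_1+\mu_2A_2+\mu_3A_3\in GL(\mathcal{H})^+$, that $A_1$ and $A_2$ are compact, and that $(0,0)\in W_{\mathbb{R}}(A_1,A_2)$. Then $F(\mathcal{H})$ is closed in $\mathbb{R}^3$.
   Context: $W_{\mathbb{R}}(A_1,A_2):=\{(\langle A_1x,x\rangle,\langle A_2x,x\rangle)\in\mathbb{R}^2 : x\in\mathcal{H},\ \|x\|=1\}$ is the joint real numerical range. $GL(\mathcal{H})^+$ denotes the set of bounded linear operators $T$ on $\mathcal{H}$ that are invertible (with bounded inverse) and positive definite, i.e. $T$ is symmetric ($\langle Tx,y\rangle=\langle x,Ty\rangle$ for all $x,y$) and $\langle Tx,x\rangle>0$ for all $x\neq 0$. *)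

(* Defs.v *)
From mathcomp Require Import all_boot all_order all_algebra.
From mathcomp Require Import all_classical all_reals all_analysis.

Set Implicit Arguments.
Unset Strict Implicit.
Unset Printing Implicit Defensive.

Import Order.TTheory GRing.Theory Num.Theory.
Import numFieldNormedType.Exports.

Local Open Scope classical_set_scope.
Local Open Scope ring_scope.

(* A real Hilbert space is rendered as a complete normed module H over a
   realType together with an inner product dot : {dot H for idfun} (a symmetric
   positive definite bilinear form) such that dot x x = `|x| ^+ 2. The norm and
   topology of H are then the ones induced by dot. *)

Definition bounded_operator (R : realType) (H : normedModType R)
    (T : H -> H) : Prop :=
  exists M : R, forall x : H, `|T x| <= M * `|x|.

Definition compact_operator (R : realType) (H : normedModType R)
    (T : H -> H) : Prop :=
  forall B : set H, bounded_set B -> precompact (T @` B).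

Definition boundedly_invertible (R : realType) (H : normedModType R)
    (T : H -> H) : Prop :=
  exists S : {linear H -> H}, [/\ bounded_operator S, cancel T S & cancel S T].

Definition GLpos (R : realType) (H : normedModType R)
    (dot : {dot H for idfun}) : set {linear H -> H} :=
  [set T | [/\ bounded_operator T,
               boundedly_invertible T,
               forall x y, dot (T x) y = dot x (T y) &
               forall x, x != 0 -> 0 < dot (T x) x]].

Definition qform (R : realType) (H : normedModType R)
    (dot : {dot H for idfun}) (A : H -> H) (x : H) : R :=
  dot (A x) x.

Definition joint_real_numerical_range (R : realType) (H : normedModType R)
    (dot : {dot H for idfun}) (A1 A2 : H -> H) : set (R * R) :=
  [set (qform dot A1 x, qform dot A2 x) | x in [set x | `|x| = 1]].

Definition quad_map (R : realType) (H : normedModType R)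
    (dot : {dot H for idfun}) (A1 A2 A3 : H -> H) (x : H) : R * R * R :=
  (qform dot A1 x, qform dot A2 x, qform dot A3 x).

(* Main.v *)
(* Along an ultrafilter U with F -> (a, b, c), the coercive form p of the
   pencil keeps U bounded, so U has a weak limit x, and compactness of A1 and A2
   gives q1 x = a and q2 x = b; only p may drop, p x <= L := lim p.  If p drops,
   the escaping part of U supplies a direction f that is p-orthogonal to x and
   to the given common zero e of q1 and q2.  In the 3-dimensional span of x, e
   and f one combination of q1 and q2 vanishes at both x and e; its null cone is
   connected up to sign, so by the intermediate value theorem along a path from
   x to e in that cone some y has q1 y = a, q2 y = b and p y = L.  The third
   coordinate then follows, since mu3 * q3 e = p e > 0 forces mu3 != 0. *)
Require Import Defs.
From mathcomp Require Import all_boot all_order all_algebra.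
From mathcomp Require Import all_classical all_reals all_analysis.
From mathcomp Require Import ring lra.

Set Implicit Arguments.
Unset Strict Implicit.
Unset Printing Implicit Defensive.

Import Order.TTheory GRing.Theory Num.Theory.
Import numFieldNormedType.Exports.

Local Open Scope classical_set_scope.
Local Open Scope ring_scope.

(** * Polarization of quadratic forms *)

(** Both terms are kept because [A] may fail to be symmetric; this is twice the bilinear form of its
    symmetric part. *)
Definition polar (R : realType) (H : normedModType R) (dot : {dot H for idfun})
    (A : H -> H) (x y : H) : R :=
  dot (A x) y + dot (A y) x.

Lemma polarC (R : realType) (H : normedModType R) (dot : {dot H for idfun})
    (A : H -> H) (x y : H) : polar dot A x y = polar dot A y x.
Proof. by rewrite /polar addrC. Qed.

Lemma dotC (R : realType) (H : normedModType R) (dot : {dot H for idfun})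
    (x y : H) : dot x y = dot y x.
Proof. by have := hermC dot x y; rewrite expr0 mul1r. Qed.

Lemma dotZl (R : realType) (H : normedModType R) (dot : {dot H for idfun})
    (a : R) (x y : H) : dot (a *: x) y = a * dot x y.
Proof. by rewrite linearZl_LR. Qed.

Lemma dotZr (R : realType) (H : normedModType R) (dot : {dot H for idfun})
    (a : R) (x y : H) : dot x (a *: y) = a * dot x y.
Proof. by rewrite linearZr_LR. Qed.

Lemma dotDl (R : realType) (H : normedModType R) (dot : {dot H for idfun})
    (x y z : H) : dot (x + y) z = dot x z + dot y z.
Proof. by rewrite linearDl. Qed.

Lemma dotDr (R : realType) (H : normedModType R) (dot : {dot H for idfun})
    (x y z : H) : dot z (x + y) = dot z x + dot z y.
Proof. by rewrite linearDr. Qed.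

Lemma dotBl (R : realType) (H : normedModType R) (dot : {dot H for idfun})
    (x y z : H) : dot (x - y) z = dot x z - dot y z.
Proof. by rewrite linearBl. Qed.

Lemma dotBr (R : realType) (H : normedModType R) (dot : {dot H for idfun})
    (x y z : H) : dot z (x - y) = dot z x - dot z y.
Proof. by rewrite linearBr. Qed.

Lemma qform_comb (R : realType) (H : normedModType R)
    (dot : {dot H for idfun}) (A : {linear H -> H}) (a b c : R) (u v w : H) :
  qform dot A (a *: u + b *: v + c *: w) =
  a ^+ 2 * qform dot A u + b ^+ 2 * qform dot A v + c ^+ 2 * qform dot A w +
  a * b * polar dot A u v + a * c * polar dot A u w + b * c * polar dot A v w.
Proof.
rewrite /qform /polar !linearD !linearZ /=.
rewrite !linearDl !linearDr /= !(dotZl, dotZr).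
ring.
Qed.

Lemma qform_lin (R : realType) (H : normedModType R)
    (dot : {dot H for idfun}) (A B : {linear H -> H}) (a b : R) (x : H) :
  qform dot (a \*: A \+ b \*: B) x = a * qform dot A x + b * qform dot B x.
Proof. by rewrite /qform /= linearDl /= !dotZl. Qed.

Lemma polar_comb (R : realType) (H : normedModType R)
    (dot : {dot H for idfun}) (A : {linear H -> H}) (a b c : R) (u v w x : H) :
  polar dot A (a *: u + b *: v + c *: w) x =
  a * polar dot A u x + b * polar dot A v x + c * polar dot A w x.
Proof.
rewrite /polar !linearD !linearZ /=.
rewrite !linearDl !linearDr /= !(dotZl, dotZr).
ring.
Qed.

Lemma polar_self (R : realType) (H : normedModType R)
    (dot : {dot H for idfun}) (A : {linear H -> H}) (u : H) :
  polar dot A u u = qform dot A u *+ 2.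
Proof. by rewrite /polar /qform mulr2n. Qed.

(** * Null cones and joint values of quadratic forms *)

(** With polynomial coordinates the form along the path is a polynomial in [t], so the intermediate
    value theorem for polynomials applies. *)
Lemma qform_path_zero (R : realType) (H : normedModType R)
    (dot : {dot H for idfun}) (A : {linear H -> H}) (a b c : {poly R})
    (u v w : H) (y := fun t => a.[t] *: u + b.[t] *: v + c.[t] *: w) :
  0 <= qform dot A (y 0) -> qform dot A (y 1) <= 0 ->
  exists2 t, 0 <= t <= 1 & qform dot A (y t) = 0.
Proof.
move=> y0 y1.
pose p : {poly R} := - (a ^+ 2 * (qform dot A u)%:P +
  b ^+ 2 * (qform dot A v)%:P + c ^+ 2 * (qform dot A w)%:P +
  a * b * (polar dot A u v)%:P + a * c * (polar dot A u w)%:P +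
  b * c * (polar dot A v w)%:P).
have pE t : p.[t] = - qform dot A (y t) by rewrite qform_comb !hornerE.
have [|t t01 /rootP] := @poly_ivt R p 0 1 ler01.
  by rewrite !pE oppr_le0 oppr_ge0 y0 y1.
by rewrite pE => /eqP; rewrite oppr_eq0 => /eqP yt; exists t.
Qed.

(* The null cone of a quadratic form on a 3-dimensional real space is connected
   up to sign: u and v are joined inside it either by one or two segments or,
   once w is made polar to both, by the conic [(1 - t)^2 : c t^2 : t (1 - t)]. *)
Lemma null_cone_zero (R : realType) (H : normedModType R)
    (dot : {dot H for idfun}) (T A : {linear H -> H}) (u v w : H) :
  (forall a b c : R, a *: u + b *: v + c *: w = 0 ->
    [/\ a = 0, b = 0 & c = 0]) ->
  qform dot T u = 0 -> qform dot T v = 0 ->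
  0 <= qform dot A u -> qform dot A v <= 0 ->
  exists y, [/\ y != 0, qform dot T y = 0 & qform dot A y = 0].
Proof.
move=> free Tu Tv Au Av.
(* If [u] and [v] are polar to each other, [T] vanishes on the whole segment joining them. *)
have [uv0|uv0] := eqVneq (polar dot T u v) 0.
  have [||t t01 At] :=
      @qform_path_zero R H dot A (1 - 'X) 'X 0 u v w; rewrite ?hornerE.
  - by rewrite subr0 !scale1r !scale0r !addr0.
  - by rewrite subrr !scale1r !scale0r !addr0 add0r.
  eexists; split; last exact: At.
    apply/eqP => /free[]; rewrite !hornerE => + t0.
    by rewrite t0 subr0 => /eqP; rewrite oner_eq0.
  by rewrite qform_comb !hornerE Tu Tv uv0; ring.
(* Since [T] vanishes at [u] and [v], the [v]-component of [w] is corrected through its pairing with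
   [u], and conversely. *)
pose k := polar dot T w v / polar dot T u v.
pose l := polar dot T w u / polar dot T u v.
pose f := - k *: u + - l *: v + 1 *: w.
have fu : polar dot T u f = 0.
  rewrite polarC polar_comb polar_self Tu (polarC _ _ v) /l.
  by field.
have fv : polar dot T v f = 0.
  rewrite polarC polar_comb polar_self Tv /k.
  by field.
have free_f a b c : a *: u + b *: v + c *: f = 0 ->
    [/\ a = 0, b = 0 & c = 0].
  rewrite /f !scalerDr !scalerA mulr1 => E.
  have /free[] : (a + c * - k) *: u + (b + c * - l) *: v + c *: w = 0.
    by rewrite -[RHS]E !scalerDl addrACA [in RHS]addrA.
  by move=> + + c0; rewrite c0 !mul0r !addr0.
have [f0|f0] := eqVneq (qform dot T f) 0.
  (* Both segments from [f], to [u] and to [v], lie in the cone; the sign of [A] at [f] tells which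
     one has the sign change. *)
  have [Af|Af] := leP 0 (qform dot A f).
    have [||t t01 At] :=
        @qform_path_zero R H dot A 0 'X (1 - 'X) u v f; rewrite ?hornerE.
    - by rewrite subr0 !scale1r !scale0r !add0r.
    - by rewrite subrr !scale1r !scale0r !addr0 add0r.
    eexists; split; last exact: At.
      apply/eqP => /free_f[_]; rewrite !hornerE => ->.
      by rewrite subr0 => /eqP; rewrite oner_eq0.
    by rewrite qform_comb !hornerE Tv f0 fv; ring.
  have [||t t01 At] :=
      @qform_path_zero R H dot A (1 - 'X) 0 'X u v f; rewrite ?hornerE.
  - by rewrite subr0 !scale1r !scale0r !addr0.
  - by rewrite subrr !scale1r !scale0r !add0r ltW.
  eexists; split; last exact: At.
    apply/eqP => /free_f[+ _]; rewrite !hornerE => + t0.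
    by rewrite t0 subr0 => /eqP; rewrite oner_eq0.
  by rewrite qform_comb !hornerE Tu f0 fu; ring.
(* On the conic [T] equals t^2 (1 - t)^2 (c [polar dot T u v] + [qform dot T f]), which this [c]
   cancels. The path ends at [c *: v], where [A] has the same sign as at [v]. *)
have [c c0 cE] : exists2 c : R, c != 0 & qform dot T f = - (c * polar dot T u v).
  exists (- qform dot T f / polar dot T u v).
    by rewrite mulf_neq0 ?oppr_eq0 ?invr_eq0.
  by rewrite divfK ?opprK.
have [||t t01 At] :=
    @qform_path_zero R H dot A ((1 - 'X) ^+ 2) (c *: 'X ^+ 2) ('X * (1 - 'X)) u v f;
    rewrite ?hornerE.
- rewrite subr0 expr1n /= mulr0 !scale1r !scale0r !addr0.
  exact: Au.
- rewrite subrr expr0n /= !mulr1 !scale0r add0r addr0.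
  have -> : qform dot A (c *: v) = c ^+ 2 * qform dot A v.
    have := qform_comb dot A 0 c 0 u v f.
    by rewrite !scale0r add0r addr0 => ->; ring.
  by rewrite mulr_ge0_le0 // sqr_ge0.
eexists; split; last exact: At.
  apply/eqP => /free_f[]; rewrite !hornerE => /eqP + /eqP.
  rewrite /= !mulf_eq0 (negbTE c0) !orbb /= => + /eqP t0.
  by rewrite t0 subr0 oner_eq0.
rewrite qform_comb !hornerE Tu Tv fu fv cE /=.
ring.
Qed.

Lemma qformZ (R : realType) (H : normedModType R) (dot : {dot H for idfun})
    (A : {linear H -> H}) (a : R) (x : H) :
  qform dot A (a *: x) = a ^+ 2 * qform dot A x.
Proof. by rewrite /qform dotZr linearZ /= dotZl mulrA expr2. Qed.

Lemma qform_sqrtZ (R : realType) (H : normedModType R)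
    (dot : {dot H for idfun}) (A : {linear H -> H}) (a : R) (x : H) :
  0 <= a -> qform dot A (Num.sqrt a *: x) = a * qform dot A x.
Proof. by move=> a0; rewrite qformZ sqr_sqrtr. Qed.

(* Instance of the convexity of the joint image of three real quadratic forms,
   one of them positive definite, in dimension at least 3 (hence f). *)
Lemma qform_ray (R : realType) (H : normedModType R)
    (dot : {dot H for idfun}) (A1 A2 P : {linear H -> H}) (e x f : H) (L : R) :
  (forall y, y != 0 -> 0 < qform dot P y) ->
  e != 0 -> qform dot A1 e = 0 -> qform dot A2 e = 0 ->
  f != 0 -> dot (P x) f = 0 -> dot (P e) f = 0 ->
  qform dot P x <= L ->
  exists y, [/\ qform dot A1 y = qform dot A1 x,
    qform dot A2 y = qform dot A2 x & qform dot P y = L].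
Proof.
move=> P_gt0 e0 A1e A2e f0 xf ef xL.
have P0 z : dot (P 0) z = 0 by rewrite linear0 -(scale0r 0) dotZl mul0r.
have Pge0 z : 0 <= qform dot P z.
  by have [->|/P_gt0/ltW//] := eqVneq z 0; rewrite /qform P0.
set a := qform dot A1 x; set b := qform dot A2 x.
have Pe := P_gt0 _ e0.
have [ab0|ab0] := eqVneq (a ^+ 2 + b ^+ 2) 0.
  have /andP[] : (a ^+ 2 == 0) && (b ^+ 2 == 0).
    by rewrite -paddr_eq0 ?sqr_ge0 // ab0.
  rewrite !sqrf_eq0 => /eqP -> /eqP ->.
  exists (Num.sqrt (L / qform dot P e) *: e).
  have L0 : 0 <= L / qform dot P e by rewrite divr_ge0 ?(ltW Pe) ?(le_trans _ xL).
  by rewrite !qform_sqrtZ // A1e A2e !mulr0 divfK // gt_eqF.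
have N0 : 0 < a ^+ 2 + b ^+ 2 by rewrite lt0r ab0 addr_ge0 ?sqr_ge0.
set N := a ^+ 2 + b ^+ 2 in N0.
have x0 : x != 0.
  apply/eqP => x0; move: N0.
  by rewrite /N /a /b x0 /qform !linear0 expr0n addr0 ltxx.
have L0 : 0 < L by rewrite (lt_le_trans _ xL) ?P_gt0.
(* [T] vanishes where (q1, q2) is parallel to (a, b), [S] measures the component along (a, b), and
   [K] vanishes where S : P = N : L. A nonzero common zero of [T] and [K] only needs rescaling. *)
pose S := a \*: A1 \+ b \*: A2.
pose T := (- b) \*: A1 \+ a \*: A2.
pose K := L \*: S \+ (- N) \*: P.
have SE z : qform dot S z = a * qform dot A1 z + b * qform dot A2 z.
  exact: qform_lin.
have TE z : qform dot T z = - b * qform dot A1 z + a * qform dot A2 z.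
  exact: qform_lin.
have KE z : qform dot K z = L * qform dot S z + - N * qform dot P z.
  exact: qform_lin.
have Sx : qform dot S x = N by rewrite SE -/a -/b /N; ring.
have Se : qform dot S e = 0 by rewrite SE A1e A2e; ring.
have [|||||y [y0 Ty Ky]] := @null_cone_zero R H dot T K x e f.
- move=> r s t E.
  have t0 : t = 0.
    have : dot (P (r *: x + s *: e + t *: f)) f = 0 by rewrite E P0.
    rewrite !linearD !linearZ /= !linearDl /= !dotZl xf ef !mulr0 !add0r.
    by move/eqP; rewrite mulf_eq0 (gt_eqF (P_gt0 _ f0)) orbF => /eqP.
  have {E} E : r *: x = (- s) *: e.
    by apply/eqP; rewrite -subr_eq0 scaleNr opprK -[X in _ == X]E t0 scale0r addr0.
  have r0 : r = 0.
    have /eqP := congr1 (qform dot S) E.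
    by rewrite !qformZ Sx Se mulr0 mulf_eq0 (gt_eqF N0) orbF sqrf_eq0 => /eqP.
  split => //; move/esym/eqP: E.
  by rewrite r0 scale0r scaler_eq0 (negbTE e0) orbF oppr_eq0 => /eqP.
- by rewrite TE -/a -/b; ring.
- by rewrite TE A1e A2e; ring.
- by rewrite KE Sx; nra.
- by rewrite KE Se; nra.
have Py := P_gt0 _ y0.
pose k := L / qform dot P y.
have k0 : 0 <= k by rewrite divr_ge0 ?ltW.
exists (Num.sqrt k *: y); rewrite !qform_sqrtZ //.
have Sy : qform dot S y = N * qform dot P y / L.
  apply: (mulfI (lt0r_neq0 L0)).
  move/eqP: Ky; rewrite KE mulNr subr_eq0 => /eqP ->.
  by field; rewrite lt0r_neq0.
have A1y : N * qform dot A1 y = a * qform dot S y.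
  by rewrite SE /N -[RHS]subr0 -(mulr0 b) -Ty TE; ring.
have A2y : N * qform dot A2 y = b * qform dot S y.
  by rewrite SE /N -[RHS]addr0 -(mulr0 a) -Ty TE; ring.
have nz := lt0r_neq0 L0; have nzP := lt0r_neq0 Py.
split.
- apply: (mulfI ab0); rewrite -/N mulrCA A1y Sy /k; field.
  by rewrite nz nzP.
- apply: (mulfI ab0); rewrite -/N mulrCA A2y Sy /k; field.
  by rewrite nz nzP.
- by rewrite /k divfK.
Qed.

(** * Cauchy-Schwarz inequalities *)

Lemma polar_sqr_le (R : realType) (H : normedModType R)
    (dot : {dot H for idfun}) (P : {linear H -> H}) (x y : H) :
  (forall z, 0 <= qform dot P z) ->
  polar dot P x y ^+ 2 <= 4 * (qform dot P x * qform dot P y).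
Proof.
move=> P_ge0.
have P2 a b : 0 <= a ^+ 2 * qform dot P x + b ^+ 2 * qform dot P y +
    a * b * polar dot P x y.
  have := P_ge0 (a *: x + b *: y + 0 *: 0).
  by rewrite qform_comb expr0n mul0r !mulr0 !mul0r !addr0.
set p := polar dot P x y in P2 *.
have := P_ge0 y; rewrite le0r => /predU1P[y0|y0].
  (* When [y] is null for [P], these coefficients turn [P2] into 0 <= - p^2. *)
  have := P2 (- p) (qform dot P x + 1).
  by rewrite y0; nra.
have := P2 (2 * qform dot P y) (- p).
have -> : (2 * qform dot P y) ^+ 2 * qform dot P x + (- p) ^+ 2 * qform dot P y +
    2 * qform dot P y * - p * p =
    qform dot P y * (4 * (qform dot P x * qform dot P y) - p ^+ 2) by ring.
by rewrite pmulr_rge0 // subr_ge0.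
Qed.

Lemma cauchy_schwarz (R : realType) (H : normedModType R)
    (dot : {dot H for idfun}) (x y : H) :
  (forall z : H, dot z z = `|z| ^+ 2) -> `|dot x y| <= `|x| * `|y|.
Proof.
move=> dot_norm.
have CS : (dot x y + dot x y) ^+ 2 <= 4 * (dot x x * dot y y).
  rewrite [X in _ + X]dotC; apply: (@polar_sqr_le R H dot idfun) => z.
  by rewrite /qform /= dot_norm sqr_ge0.
rewrite -(@ler_pXn2r _ 2) ?nnegrE ?mulr_ge0 // real_normK ?num_real //.
rewrite !dot_norm in CS.
rewrite exprMn; nra.
Qed.

(** * Weak limits along ultrafilters *)

Lemma ultra_compact_cvg (T : Type) (V : topologicalType)
    (U : set_system T) (UU : UltraFilter U) (g : T -> V) (K : set V) :
  compact K -> U (g @^-1` K) -> exists l : V, g @ U --> l.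
Proof.
move=> cK UK.
have [l [_ gl]] := cK (g @ U) _ UK.
exists l => N Nl.
have [//|UN] := in_ultra_setVsetC (g @^-1` N) UU.
have [z []] := gl (~` N) N UN Nl.
by [].
Qed.

(** Midpoints are exactly what the parallelogram law consumes. *)
Definition midconvex (R : realType) (H : normedModType R) (C : set H) : Prop :=
  forall y z, C y -> C z -> C (2^-1 *: (y + z)).

Lemma midconvexI (R : realType) (H : normedModType R) (C D : set H) :
  midconvex C -> midconvex D -> midconvex (C `&` D).
Proof. by move=> cC cD y z [Cy Dy] [Cz Dz]; split; [exact: cC|exact: cD]. Qed.

Lemma parallelogram (R : realType) (H : normedModType R)
    (dot : {dot H for idfun}) (y z : H) :
  (forall z : H, dot z z = `|z| ^+ 2) ->
  `|y - z| ^+ 2 =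
  2 * `|y| ^+ 2 + 2 * `|z| ^+ 2 - 4 * `|2^-1 *: (y + z)| ^+ 2.
Proof.
move=> dot_norm; rewrite -!dot_norm dotZl dotZr dotBl !dotBr dotDl !dotDr.
rewrite (dotC dot z y).
by field.
Qed.

(* The points of nearly minimal norm in a midconvex set of [U] form a Cauchy
   filter when the set shrinks along [U], by the parallelogram law. *)
Lemma midconvex_limit (R : realType) (H : completeNormedModType R)
    (dot : {dot H for idfun}) (U : set_system H) (M : R) :
  (forall z : H, dot z z = `|z| ^+ 2) -> ProperFilter U ->
  U [set y | `|y| <= M] ->
  exists x, forall C, U C -> midconvex C ->
    forall e, 0 < e -> exists2 y, C y & `|x - y| < e.
Proof.
move=> dot_norm PU UM.
(* The supremum of [E] is the limiting squared distance from 0 to the midconvex sets of [U] as they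
   shrink. *)
pose E := [set v : R | exists C,
  [/\ U C, midconvex C & forall y, C y -> v <= `|y| ^+ 2]].
have supE : has_sup E.
  split.
    exists 0, setT; split; [exact: filterT|by []|by move=> y _; exact: sqr_ge0].
  exists (M ^+ 2) => v [C [UC _ Cv]].
  have [y [Cy yM]] := filter_ex (filterI UC UM).
  rewrite (le_trans (Cv _ Cy)) // ler_pXn2r ?nnegrE //.
  exact: le_trans yM.
pose d := sup E.
have near_min C e : U C -> midconvex C -> 0 < e ->
    exists2 y, C y & `|y| ^+ 2 < d + e.
  move=> UC cC e0; apply: contrapT => /forall2NP Ce.
  have : d + e <= d.
    apply: ub_le_sup; first by case: supE.
    exists C; split=> // y Cy; rewrite leNgt; apply/negP.
    by case: (Ce y).
  by rewrite gerDl leNgt e0.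
pose D := [set i : set H * R | [/\ U i.1, midconvex i.1 & 0 < i.2]].
pose G (i : set H * R) := [set y | i.1 y /\ `|y| ^+ 2 < d + i.2].
pose F := filter_from D G.
have DT C e : U C -> midconvex C -> 0 < e -> D (C, e) by [].
have FF : ProperFilter F.
  apply: filter_from_proper; last first.
    by move=> [C e] [UC cC e0]; have [y Cy ye] := near_min C e UC cC e0; exists y.
  apply: filter_from_filter.
    by exists (setT, 1); split=> //=; exact: filterT.
  move=> [C e] [C' e'] [/= UC cC e0] [/= UC' cC' e0'].
  exists (C `&` C', Num.min e e').
    by split; [exact: filterI|exact: midconvexI|rewrite lt_min e0 e0'].
  move=> y [/= [Cy C'y] ye]; split; split=> //=; apply: (lt_le_trans ye).
    by rewrite lerD2l ge_min lexx.
  by rewrite lerD2l ge_min lexx orbT.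
have : cauchy F.
  apply: cauchy_exP => e e0.
  (* Two points of squared norm below d + h with midpoint of squared norm above d - h are at squared
     distance below 4 (d + h) - 4 (d - h) = 8 h. *)
  pose h := e ^+ 2 / 8.
  have h0 : 0 < h by rewrite divr_gt0 ?exprn_gt0.
  have [v [C [UC cC Cv]] dv] := sup_adherent h0 supE.
  have [x0 Cx0 x0h] := near_min C h UC cC h0.
  exists x0, (C, h); first exact: DT.
  move=> y [/= Cy yh]; rewrite -ball_normE /=.
  rewrite -(@ltr_pXn2r _ 2) ?nnegrE ?(ltW e0) // (parallelogram _ _ dot_norm).
  have := Cv _ (cC _ _ Cx0 Cy).
  have -> : e ^+ 2 = 8 * h by rewrite /h; field.
  rewrite -/d in dv; lra.
move=> /cauchy_cvg /cvg_ex[x Fx]; exists x => C UC cC e e0.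
have FC : F C by exists (C, 1) => [|y []//]; exact: DT.
have FB : F (ball x e) by apply: Fx; exact: nbhsx_ballx.
have [y [Cy]] := filter_ex (filterI FC FB).
by rewrite -ball_normE; exists y.
Qed.

(** Compactness gives some limit [w] of [A]; the preimage of a small ball around [w] is midconvex
    and in [U], so [x] is close to it and [A x] is close to [w]. This serves both functionals, which
    makes [x] a weak limit, and compact operators. *)
Lemma midconvex_limit_cvg (R : realType) (H W : normedModType R)
    (U : set_system H) (UU : UltraFilter U) (x : H) (A : H -> W) (M : R)
    (K : set W) :
  (forall C, U C -> midconvex C ->
    forall e, 0 < e -> exists2 y, C y & `|x - y| < e) ->
  linear A -> (forall y, `|A y| <= M * `|y|) ->
  compact K -> U (A @^-1` K) -> A @ U --> A x.
Proof.
move=> Ux linA bA cK UK.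
have [w Aw] := ultra_compact_cvg UU cK UK.
suff -> : A x = w by [].
apply/eqP; rewrite -subr_eq0 -normr_le0; apply/ler_addgt0Pr => e e0.
rewrite add0r.
have AB y z : A (y - z) = A y - A z.
  by rewrite addrC -scaleN1r linA scaleN1r addrC.
pose d := e / (`|M| + 1).
have M1 : 0 < `|M| + 1 by rewrite ltr_wpDl.
have d0 : 0 < d by rewrite divr_gt0.
have UC : U [set y | `|w - A y| <= d].
  by move/cvgrPdist_le : Aw => /(_ d d0).
have cC : midconvex [set y | `|w - A y| <= d].
  move=> y z /= yd zd.
  have -> : w - A (2^-1 *: (y + z)) = 2^-1 *: ((w - A y) + (w - A z)).
    have -> : 2^-1 *: (y + z) = 2^-1 *: y + (2^-1 *: z + 0).
      by rewrite addr0 scalerDr.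
    rewrite !linA.
    have -> : A 0 = 0 by rewrite -(subrr x) AB subrr.
    rewrite addr0 addrACA -mulr2n scalerDr -[w *+ 2]scaler_nat scalerA mulVf ?pnatr_eq0//.
    by rewrite scale1r scalerDr !scalerN opprD.
  rewrite normrZ gtr0_norm // ler_pdivrMl // (le_trans (ler_normD _ _)) //.
  by rewrite mulrDl mul1r lerD.
have [y /= Cy xy] := Ux _ UC cC _ d0.
rewrite (_ : A x - w = A (x - y) - (w - A y)); last first.
  by rewrite AB opprB addrA subrK.
rewrite (le_trans (ler_normB _ _)) //.
have -> : e = `|M| * d + d by rewrite /d -[X in _ = _ + X]mul1r -mulrDl mulrC divfK // gt_eqF.
rewrite lerD // (le_trans (bA _)) // (le_trans (_ : _ <= `|M| * `|x - y|)) //.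
  by rewrite ler_wpM2r // ler_norm.
by rewrite ler_wpM2l // ltW.
Qed.

(** * Coercivity and the behaviour of forms under weak limits *)

(** Cauchy-Schwarz for the form of [P], applied to [S x] and [x] with [S] the inverse of [P], bounds
    |x|^4 by <x, S x> <P x, x>, and [S] is bounded. *)
Lemma coercive (R : realType) (H : normedModType R) (dot : {dot H for idfun})
    (P : {linear H -> H}) :
  (forall z : H, dot z z = `|z| ^+ 2) -> GLpos dot P ->
  exists2 k : R, 0 <= k & forall x, `|x| ^+ 2 <= k * qform dot P x.
Proof.
move=> dot_norm [_ [S [[M bS] _ SP]] symP P_gt0].
have P_ge0 z : 0 <= qform dot P z.
  have [->|/P_gt0/ltW//] := eqVneq z 0; by rewrite /qform !linear0.
exists `|M| => // x.
have [->|x0] := eqVneq x 0; first by rewrite normr0 expr0n mulr_ge0.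
have := @polar_sqr_le R H dot P (S x) x P_ge0.
rewrite /polar (symP x) {1}/qform !SP !dot_norm => CS.
have nx : 0 < `|x| ^+ 2 by rewrite exprn_gt0 ?normr_gt0.
have xS : dot x (S x) <= `|M| * `|x| ^+ 2.
  rewrite (le_trans (ler_norm _)) // (le_trans (cauchy_schwarz _ _ dot_norm)) //.
  rewrite expr2 mulrCA ler_wpM2l // (le_trans (bS _)) //.
  by rewrite ler_wpM2r // ler_norm.
have := P_ge0 x.
move: CS xS nx; set q := qform dot P x; set n := `|x| ^+ 2.
set m := `|M|; set s := dot x (S x) => CS xS nx q0.
rewrite -(ler_pM2l nx).
have : s * q <= m * n * q by rewrite ler_wpM2r.
by lra.
Qed.

Lemma cvg_qform (R : realType) (H : normedModType R) (dot : {dot H for idfun})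
    (U : set_system H) (PU : ProperFilter U) (A : {linear H -> H}) (x : H)
    (M : R) :
  (forall z : H, dot z z = `|z| ^+ 2) -> U [set y | `|y| <= M] ->
  A @ U --> A x -> dot y (A x) @[y --> U] --> dot x (A x) ->
  qform dot A @ U --> qform dot A x.
Proof.
move=> dot_norm UM AU xU; apply/cvgrPdist_le => e e0.
have d0 : 0 < e / 2 / (`|M| + 1) by rewrite !divr_gt0 // ltr_wpDl.
have e20 : 0 < e / 2 by rewrite divr_gt0.
move/cvgrPdist_le : AU => /(_ _ d0) AU.
move/cvgrPdist_le : xU => /(_ _ e20) xU.
apply: filterS3 UM AU xU => y /= yM yA yx.
rewrite /qform.
have -> : dot (A x) x - dot (A y) y =
    (dot x (A x) - dot y (A x)) + dot (A x - A y) y.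
  by rewrite dotBl (dotC dot x) (dotC dot y) addrA subrK.
rewrite (le_trans (ler_normD _ _)) // [e]splitr lerD //.
rewrite (le_trans (cauchy_schwarz _ _ dot_norm)) //.
have M1 : 0 < `|M| + 1 by rewrite ltr_wpDl.
have -> : e / 2 = e / 2 / (`|M| + 1) * (`|M| + 1) by rewrite divfK // gt_eqF.
apply: ler_pM => //; rewrite (le_trans yM) // (le_trans (ler_norm _)) //.
by rewrite lerDl.
Qed.

(** The limit is the [P]-energy lost in the weak limit; positivity of [P] then makes it
    nonnegative. *)
Lemma cvg_qformB (R : realType) (H : normedModType R) (dot : {dot H for idfun})
    (U : set_system H) (PU : ProperFilter U) (P : {linear H -> H}) (x : H)
    (L : R) :
  (forall y z, dot (P y) z = dot y (P z)) ->
  dot y (P x) @[y --> U] --> dot x (P x) -> qform dot P y @[y --> U] --> L ->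
  qform dot P (y - x) @[y --> U] --> L - qform dot P x.
Proof.
move=> symP Ux UL.
have E y : qform dot P (y - x) = qform dot P y - 2 * dot y (P x) + qform dot P x.
  rewrite /qform (linearB P) dotBl !dotBr (symP y x) (dotC dot (P x) y).
  by ring.
under eq_fun do rewrite E.
have -> : L - qform dot P x = L - 2 * dot x (P x) + qform dot P x.
  by rewrite /qform symP; ring.
apply: cvgD; last exact: cvg_cst.
by apply: cvgB => //; apply: cvgM => //; exact: cvg_cst.
Qed.

(* If P-energy is lost in the weak limit x of U, the lost part points, up to
   an error vanishing along U, in a direction P-orthogonal to x and e. *)
Lemma orthogonal_direction (R : realType) (H : normedModType R)
    (dot : {dot H for idfun}) (U : set_system H) (PU : ProperFilter U)
    (P : {linear H -> H}) (x e : H) (L : R) :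
  (forall y z, dot (P y) z = dot y (P z)) ->
  (forall z, z != 0 -> 0 < qform dot P z) ->
  (forall v, dot y v @[y --> U] --> dot x v) ->
  qform dot P y @[y --> U] --> L -> qform dot P x < L -> e != 0 ->
  exists f, [/\ f != 0, dot (P x) f = 0 & dot (P e) f = 0].
Proof.
move=> symP P_gt0 wU UL xL e0.
have cU := cvg_qformB PU symP (wU (P x)) UL.
have w0 v : dot (y - x) v @[y --> U] --> (0 : R).
  under eq_fun do rewrite dotBl.
  by rewrite -(subrr (dot x v)); apply: cvgB => //; exact: cvg_cst.
(* Gram-Schmidt for [P]: [u] is the part of [x] orthogonal to [e], and [h y] is the energy of
   [y - x] once its components along [e] and [u] are removed. These components vanish along [U]. *)
pose k := dot (P x) e / qform dot P e.
pose u := x - k *: e.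
pose s y := dot (y - x) (P e); pose t y := dot (y - x) (P u).
pose h y := qform dot P (y - x) - s y / qform dot P e * s y
  - t y / qform dot P u * t y.
have hU : h y @[y --> U] --> L - qform dot P x.
  have -> : L - qform dot P x = L - qform dot P x
      - 0 / qform dot P e * 0 - 0 / qform dot P u * 0.
    by rewrite !mulr0 !subr0.
  have q0 v : dot (y - x) v / qform dot P e @[y --> U] --> 0 / qform dot P e.
    by apply: cvgM => //; exact: cvg_cst.
  have q1 v : dot (y - x) v / qform dot P u @[y --> U] --> 0 / qform dot P u.
    by apply: cvgM => //; exact: cvg_cst.
  apply: cvgB; last by apply: cvgM; [exact: q1|exact: w0].
  apply: cvgB => //; apply: cvgM; [exact: q0|exact: w0].
have d0 : 0 < L - qform dot P x by rewrite subr_gt0.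
have [y hy] := filter_ex (cvgr_gt _ hU _ d0).
(* Naming [y - x] abstractly keeps the linearity rewrites from splitting it. *)
have [z [sz tz hz]] : exists z, [/\ s y = dot z (P e), t y = dot z (P u) &
    h y = qform dot P z - s y / qform dot P e * s y
      - t y / qform dot P u * t y].
  by exists (y - x).
pose f := z - (s y / qform dot P e) *: e - (t y / qform dot P u) *: u.
have Pe0 : qform dot P e != 0 by rewrite gt_eqF ?P_gt0.
have eu : dot (P e) u = 0.
  rewrite /u dotBr dotZr /k symP (dotC dot (P x)) -/(qform dot P e) divfK //.
  by rewrite subrr.
have ef : dot (P e) f = 0.
  rewrite /f !dotBr !dotZr eu mulr0 subr0 -/(qform dot P e) divfK //.
  by rewrite sz dotC subrr.
have uf : dot (P u) f = 0.
  rewrite /f !dotBr !dotZr (symP u e) (dotC dot u) eu mulr0 subr0.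
  rewrite -/(qform dot P u) (dotC dot (P u)) -tz.
  (* If [x] is a multiple of [e], then [u = 0] and [t y = 0]. *)
  have [u0|u0] := eqVneq u 0.
    by rewrite /t u0 linear0 -(scale0r 0) dotZr !mul0r subrr.
  by rewrite divfK ?subrr // gt_eqF ?P_gt0.
have xf : dot (P x) f = 0.
  have -> : x = u + k *: e by rewrite /u subrK.
  by rewrite (linearD P) (linearZ_LR P) /= dotDl dotZl uf ef mulr0 addr0.
exists f; split => //; apply/eqP => f0.
suff : qform dot P f = h y by rewrite f0 /qform !linear0 => h0; rewrite -h0 ltxx in hy.
rewrite hz {1}/qform {1}/f !(linearB P) !(linearZ_LR P) /= !dotBl !dotZl ef uf.
rewrite !mulr0 !subr0 /f !dotBr !dotZr (symP z e) (symP z u) -sz -tz.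
by rewrite /qform.
Qed.

(** * Closedness of the range *)

(** A filter on the range converging to [p] pulls back to a proper filter on [T], which extends to
    an ultrafilter. *)
Lemma closed_range_ultra (T : Type) (V : topologicalType) (f : T -> V) :
  (forall (U : set_system T) (p : V), UltraFilter U -> f @ U --> p -> range f p) ->
  closed (range f).
Proof.
move=> fU p; rewrite closureEcvg => -[G PG [Gp rG]].
pose F0 := filter_from G (fun B => f @^-1` B).
have PF0 : ProperFilter F0.
  apply: filter_from_proper; last first.
    move=> B GB; have Gr : G (range f) by exact: rG.
    by have [q [Bq [x _ xq]]] := filter_ex (filterI GB Gr); exists x; rewrite /= xq.
  apply: filter_from_filter; first by exists setT; exact: filterT.
  by move=> B C GB GC; exists (B `&` C) => //; exact: filterI.
have [U [UU F0U]] := ultraFilterLemma PF0.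
by apply: (fU U p UU) => N Np; apply: F0U; exists N => //; exact: Gp.
Qed.

Theorem theorem2p7 (R : realType) (H : completeNormedModType R)
    (dot : {dot H for idfun})
    (dot_norm : forall x : H, dot x x = `|x| ^+ 2)
    (A1 A2 A3 : {linear H -> H})
    (bA1 : bounded_operator A1)
    (bA2 : bounded_operator A2)
    (bA3 : bounded_operator A3)
    (posdef_pencil : exists mu1 mu2 mu3 : R,
       GLpos dot (mu1 \*: A1 \+ mu2 \*: A2 \+ mu3 \*: A3))
    (cA1 : compact_operator A1)
    (cA2 : compact_operator A2)
    (W0 : joint_real_numerical_range dot A1 A2 (0, 0)) :
  closed (range (quad_map dot A1 A2 A3)).
Proof.
case: W0 => e /= e1 [A1e A2e].
case: posdef_pencil => mu1 [mu2 [mu3]].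
set P : {linear H -> H} := (X in GLpos dot X) => GLP.
have PE y : qform dot P y =
    mu1 * qform dot A1 y + mu2 * qform dot A2 y + mu3 * qform dot A3 y.
  by rewrite /qform /= !dotDl !dotZl.
have [_ _ symP P_gt0] := GLP.
have e0 : e != 0 by rewrite -normr_gt0 e1.
have P_ge0 y : 0 <= qform dot P y.
  by have [->|/P_gt0/ltW//] := eqVneq y 0; rewrite /qform !linear0.
have mu3_neq0 : mu3 != 0.
  have := P_gt0 _ e0; rewrite -/(qform dot P e) PE A1e A2e.
  by apply: contraTneq => ->; rewrite !mulr0 mul0r !addr0 ltxx.
have [k k0 kP] := coercive dot_norm GLP.
apply: closed_range_ultra => U [[a b] c] UU FU.
have A1U : qform dot A1 @ U --> a.
  by apply: (cvg_comp _ _ (cvg_comp _ _ FU cvg_fst) cvg_fst).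
have A2U : qform dot A2 @ U --> b.
  by apply: (cvg_comp _ _ (cvg_comp _ _ FU cvg_fst) cvg_snd).
have A3U : qform dot A3 @ U --> c.
  by apply: (cvg_comp _ _ FU cvg_snd).
pose L := mu1 * a + mu2 * b + mu3 * c.
have PU : qform dot P y @[y --> U] --> L.
  under eq_fun do rewrite PE.
  by apply: cvgD; [apply: cvgD|]; apply: cvgM => //; exact: cvg_cst.
(* Coercivity bounds |y|^2 by k (|L| + 1); the final 1 gives M <= M^2, hence |y| <= M. *)
pose M := k * (`|L| + 1) + 1.
have M1 : 1 <= M by rewrite lerDr mulr_ge0.
have UM : U [set y | `|y| <= M].
  have LL : L < `|L| + 1 by rewrite (le_lt_trans (ler_norm _)) // ltrDl.
  apply: filterS (cvgr_le _ PU _ LL) => y /= yL.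
  have M0 : 0 <= M by exact: le_trans ler01 M1.
  rewrite -(@ler_pXn2r _ 2) ?nnegrE // (le_trans (kP y)) //.
  have : k * qform dot P y <= M by rewrite (le_trans (ler_wpM2l k0 yL)) // lerDl.
  by move=> /le_trans; apply; rewrite expr2 ler_peMr.
have [x Ux] := midconvex_limit dot_norm _ UM.
have wU v : dot y v @[y --> U] --> dot x v.
  apply: (@midconvex_limit_cvg R H R^o U UU x (fun y => dot y v) `|v|
    `[- (M * `|v|), M * `|v|] Ux).
  - by move=> r y z; rewrite dotDl dotZl.
  - by move=> y; rewrite mulrC cauchy_schwarz.
  - exact: segment_compact.
  apply: filterS UM => y /= yM.
  rewrite in_itv /= -ler_norml (le_trans (cauchy_schwarz _ _ dot_norm)) //.
  by rewrite ler_wpM2r.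
have bM : bounded_set [set y : H | `|y| <= M].
  exists M; split; first exact: num_real.
  by move=> N MN y /= /le_trans; apply; exact: ltW.
have qU (A : {linear H -> H}) : bounded_operator A -> compact_operator A ->
    qform dot A @ U --> qform dot A x.
  move=> [N bA] cA; apply: (cvg_qform _ dot_norm UM _ (wU (A x))).
  apply: (midconvex_limit_cvg UU Ux _ bA).
  - exact: linearP.
  - by have := cA _ bM; rewrite precompactE; exact.
  by apply: filterS UM => y /= yM; apply: subset_closure; exists y.
have A1x : qform dot A1 x = a.
  exact: (cvg_unique _ (qU A1 bA1 cA1) A1U).
have A2x : qform dot A2 x = b.
  exact: (cvg_unique _ (qU A2 bA2 cA2) A2U).
(* Otherwise [qform dot P (y - x)] would be negative for some [y]. *)
have xL : qform dot P x <= L.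
  rewrite leNgt -subr_lt0; apply/negP => Lx.
  have [y] := filter_ex (cvgr_lt _ (cvg_qformB _ symP (wU (P x)) PU) _ Lx).
  by rewrite ltNge P_ge0.
suff [y [A1y A2y Py]] : exists y,
    [/\ qform dot A1 y = a, qform dot A2 y = b & qform dot P y = L].
  exists y => //; rewrite /quad_map A1y A2y; congr (_, _, _).
  apply: (mulfI mu3_neq0); apply: (addrI (mu1 * a + mu2 * b)).
  by rewrite -/L -Py PE A1y A2y.
move: xL; rewrite le_eqVlt => /predU1P[xL|xL]; first by exists x.
have [f [f0 xf ef]] := orthogonal_direction _ symP P_gt0 wU PU xL e0.
rewrite -A1x -A2x.
exact: (qform_ray P_gt0 e0 A1e A2e f0 xf ef (ltW xL)).
Qed.
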